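(* Consider the linear model $\mathbf{y}=\boldsymbol{\Phi}\boldsymbol{\theta}_\circ+\boldsymbol{\varepsilon}$, where $\boldsymbol{\Phi}\in\mathbb{R}^{n\times d}$ is fixed, $\boldsymbol{\varepsilon}$ is a zero-mean random vector in $\mathbb{R}^n$ with covariance matrix $\mathbf{V}_\circ\succeq\mathbf{0}$, and $\boldsymbol{\theta}_\circ$ is a random vector in $\mathbb{R}^d$, independent of $\boldsymbol{\varepsilon}$, with $\mathbb{E}[\boldsymbol{\theta}_\circ]=\mathbf{0}$ and $\operatorname{Cov}[\boldsymbol{\theta}_\circ]=\mathbf{C}_\circ\succeq\mathbf{0}$. Among all linear estimators, the minimum marginalized mean-squared error $\mathbb{E}[\mathrm{MSE}(\boldsymbol{\theta}_\circ)]$ is attained by $\widehat{\boldsymbol{\theta}}(\mathbf{C},\mathbf{V})$ with weight matrices $$\mathbf{C}=\alpha\mathbf{C}_\circ\quad\text{and}\quad\mathbf{V}=\alpha\mathbf{V}_\circ,$$ for any $\alpha>0$.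
   Context: $\mathbf{X}^\dagger$ is the Moore-Penrose pseudoinverse, $\mathcal{R}(\mathbf{M})$ the range of $\mathbf{M}$, and $\|\mathbf{x}\|_{\mathbf{W}}=\sqrt{\mathbf{x}^\top\mathbf{W}\mathbf{x}}$ for $\mathbf{W}\succeq\mathbf{0}$. A linear estimator is one of the form $\widehat{\boldsymbol{\theta}}=\mathbf{K}\mathbf{y}$ with $\mathbf{K}$ a $d\times n$ matrix independent of $\mathbf{y}$. $\mathrm{MSE}(\boldsymbol{\theta}_\circ)=\mathbb{E}[\|\boldsymbol{\theta}_\circ-\widehat{\boldsymbol{\theta}}\|_2^2]$ with expectation over $\boldsymbol{\varepsilon}$ (for given $\boldsymbol{\theta}_\circ$); the marginalized mean-squared error $\mathbb{E}[\mathrm{MSE}(\boldsymbol{\theta}_\circ)]$ additionally averages over $\boldsymbol{\theta}_\circ$. For positive semi-definite $\mathbf{C}$ ($d\times d$) and $\mathbf{V}$ ($n\times n$), $\widehat{\boldsymbol{\theta}}(\mathbf{C},\mathbf{V})$ is the minimizer of $\|\mathbf{y}-\boldsymbol{\Phi}\boldsymbol{\theta}\|_{\mathbf{V}^\dagger}^2+\|\boldsymbol{\theta}\|_{\mathbf{C}^\dagger}^2$ over $\{\boldsymbol{\theta}:\mathbf{y}-\boldsymbol{\Phi}\boldsymbol{\theta}\in\mathcal{R}(\mathbf{V}),\ \boldsymbol{\theta}\in\mathcal{R}(\mathbf{C})\}$; it equals $\mathbf{C}\boldsymbol{\Phi}^\top\mathbf{R}^\dagger\mathbf{y}$ with $\mathbf{R}=\boldsymbol{\Phi}\mathbf{C}\boldsymbol{\Phi}^\top+\mathbf{V}$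 whenever $\mathbf{y}\in\mathcal{R}(\mathbf{R})$. *)

(* Defs.v *)
From HB Require Import structures.
From mathcomp Require Import all_boot all_order all_algebra.
From mathcomp Require Import all_classical all_reals all_analysis.

Set Implicit Arguments.
Unset Strict Implicit.
Unset Printing Implicit Defensive.
Import Order.TTheory GRing.Theory Num.Theory.
Import numFieldNormedType.Exports.

Local Open Scope classical_set_scope.
Local Open Scope ring_scope.

Definition psd (R : realType) (n : nat) (A : 'M[R]_n) : Prop :=
  A^T = A /\ forall x : 'cV[R]_n, 0 <= (x^T *m A *m x) 0 0.

(* The range is the column space: vectors are columns throughout. *)
Definition mx_range (R : realType) (m n : nat) (M : 'M[R]_(m, n)) :
  set 'cV[R]_m := range (fun x : 'cV[R]_n => M *m x).

Definition is_mp_pinv (R : realType) (m n : nat) (A : 'M[R]_(m, n))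
    (X : 'M[R]_(n, m)) : Prop :=
  [/\ A *m X *m A = A, X *m A *m X = X,
      (A *m X)^T = A *m X & (X *m A)^T = X *m A].

(* Moore-Penrose inverse; mp_pinvP and mp_pinv_unique below show that the
   default value 0 is never used. It is not pinvmx of mxalgebra. *)
Definition mp_pinv (R : realType) (m n : nat) (A : 'M[R]_(m, n)) :
  'M[R]_(n, m) := xget 0 [set X | is_mp_pinv A X].

Lemma row_free_gram_unit (R : realType) (m n : nat) (G : 'M[R]_(m, n)) :
  row_free G -> G *m G^T \in unitmx.
Proof.
move=> Gfree; rewrite -row_free_unit; apply: inj_row_free => v vGG.
have : ((v *m G) *m (v *m G)^T) 0 0 = 0.
  by rewrite trmx_mul mulmxA -(mulmxA v) vGG mul0mx mxE.
rewrite mxE => /eqP; rewrite psumr_eq0; last first.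
  by move=> i _; rewrite [X in _ * X]mxE -expr2 sqr_ge0.
move=> /allP h; apply: (row_free_inj Gfree); rewrite mul0mx.
apply/rowP => i; have := h i (mem_index_enum i).
by rewrite [X in _ * X]mxE -expr2 sqrf_eq0 [X in _ -> _ = X]mxE => /eqP.
Qed.

Lemma mp_pinvP (R : realType) (m n : nat) (A : 'M[R]_(m, n)) :
  is_mp_pinv A (mp_pinv A).
Proof.
suff [X hX] : exists X, is_mp_pinv A X by apply: (xgetPex 0); exists X.
have [k [B [C [AE Bfree Cfree]]]] :
    exists (k : nat) (B : 'M[R]_(m, k)) (C : 'M[R]_(k, n)),
    [/\ A = B *m C, row_free B^T & row_free C].
  exists (\rank A), (col_base A), (row_base A); split.
  - by rewrite mulmx_base.
  - by rewrite /row_free mxrank_tr; exact: col_base_full.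
  - exact: row_base_free.
have uC : C *m C^T \in unitmx by exact: row_free_gram_unit.
have uB : B^T *m B \in unitmx.
  by have := row_free_gram_unit Bfree; rewrite trmxK.
pose P := invmx (C *m C^T); pose Q := invmx (B^T *m B).
have CP : C *m C^T *m P = 1%:M by rewrite mulmxV.
have QB : Q *m (B^T *m B) = 1%:M by rewrite mulVmx.
have PT : P^T = P by rewrite trmx_inv trmx_mul trmxK.
have QT : Q^T = Q by rewrite trmx_inv trmx_mul trmxK.
pose X := C^T *m P *m Q *m B^T.
have AX : A *m X = B *m Q *m B^T.
  have CX : C *m X = Q *m B^T by rewrite /X !mulmxA CP mul1mx.
  by rewrite AE -mulmxA CX mulmxA.
have XA : X *m A = C^T *m P *m C.
  by rewrite AE /X -!mulmxA (mulmxA B^T) (mulmxA Q) QB mul1mx.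
exists X; split.
- by rewrite AX AE -!mulmxA (mulmxA B^T) (mulmxA Q) QB mul1mx.
- rewrite XA /X -!mulmxA (mulmxA C C^T) (mulmxA (C *m C^T) P) CP.
  by rewrite mul1mx.
- by rewrite AX !trmx_mul trmxK QT mulmxA.
- by rewrite XA !trmx_mul trmxK PT mulmxA.
Qed.

Lemma mp_pinv_unique (R : realType) (m n : nat) (A : 'M[R]_(m, n)) X Y :
  is_mp_pinv A X -> is_mp_pinv A Y -> X = Y.
Proof.
move=> [AXA XAX AXT XAT] [AYA YAY AYT YAT].
have e1 : A *m X = A *m Y.
  by rewrite -AXT -{1}AYA -!mulmxA (mulmxA A Y) trmx_mul AXT AYT !mulmxA AXA.
have e2 : X *m A = Y *m A.
  by rewrite -XAT -{1}AYA !mulmxA -(mulmxA _ Y) trmx_mul XAT YAT -!mulmxA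
     (mulmxA A X) AXA.
by rewrite -XAX -mulmxA e1 mulmxA e2 YAY.
Qed.

Definition wnorm (R : realType) (n : nat) (W : 'M[R]_n) (x : 'cV[R]_n) : R :=
  Num.sqrt ((x^T *m W *m x) 0 0).

Definition wls_objective (R : realType) (n d : nat) (Phi : 'M[R]_(n, d))
    (C : 'M[R]_d) (V : 'M[R]_n) (y : 'cV[R]_n) (t : 'cV[R]_d) : R :=
  wnorm (mp_pinv V) (y - Phi *m t) ^+ 2 + wnorm (mp_pinv C) t ^+ 2.

Definition wls_feasible (R : realType) (n d : nat) (Phi : 'M[R]_(n, d))
    (C : 'M[R]_d) (V : 'M[R]_n) (y : 'cV[R]_n) : set 'cV[R]_d :=
  [set t | mx_range V (y - Phi *m t) /\ mx_range C t].

Definition wls_argmin (R : realType) (n d : nat) (Phi : 'M[R]_(n, d))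
    (C : 'M[R]_d) (V : 'M[R]_n) (y : 'cV[R]_n) : set 'cV[R]_d :=
  [set t | wls_feasible Phi C V y t /\
     forall t', wls_feasible Phi C V y t' ->
       wls_objective Phi C V y t <= wls_objective Phi C V y t'].

(* The feasible set is empty exactly when y lies outside
   mx_range (Phi *m C *m Phi^T + V); the estimator has the junk value 0 there. *)
Definition wls_estimator (R : realType) (n d : nat) (Phi : 'M[R]_(n, d))
    (C : 'M[R]_d) (V : 'M[R]_n) (y : 'cV[R]_n) : 'cV[R]_d :=
  xget 0 (wls_argmin Phi C V y).

(* Random vectors are random variables valued in n.-tuple R, which carries the
   product (= Borel) sigma-algebra; the library has none on 'cV[R]_n. *)
Definition colt (R : realType) (n : nat) (x : n.-tuple R) : 'cV[R]_n :=
  \col_i tnth x i.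

Definition independent_RV (d d1 d2 : measure_display) (T : measurableType d)
    (T1 : measurableType d1) (T2 : measurableType d2) (R : realType)
    (P : probability T R) (X : {RV P >-> T1}) (Y : {RV P >-> T2}) : Prop :=
  forall (A : set T1) (B : set T2), measurable A -> measurable B ->
    P ((X @^-1` A) `&` (Y @^-1` B)) = (P (X @^-1` A) * P (Y @^-1` B))%E.
Arguments independent_RV {d d1 d2 T T1 T2 R} P X Y.

(* Square integrability is part of having a covariance matrix; it is stated
   because expectation and covariance are total functions here. *)
Definition centered_with_cov (dp : measure_display) (T : measurableType dp)
    (R : realType) (P : probability T R) (n : nat)
    (X : {RV P >-> n.-tuple R}) (V : 'M[R]_n) : Prop :=
  let comp i := fun w => tnth (X w) i in
  [/\ forall i, comp i \in Lfun P 2%:E,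
      forall i, ('E_P[comp i] = 0)%E &
      forall i j, covariance P (comp i) (comp j) = (V i j)%:E].
Arguments centered_with_cov {dp T R} P {n} X V.

Definition sqnorm2 (R : realType) (n : nat) (x : 'cV[R]_n) : R :=
  \sum_i x i 0 ^+ 2.

(* The mean-squared error of an estimator h at a fixed parameter t: the
   expectation is over the noise only. *)
Definition MSE (dp : measure_display) (T : measurableType dp)
    (R : realType) (P : probability T R) (n d : nat) (Phi : 'M[R]_(n, d))
    (eps : {RV P >-> n.-tuple R}) (h : 'cV[R]_n -> 'cV[R]_d)
    (t : 'cV[R]_d) : \bar R :=
  ('E_P[fun w => sqnorm2 (t - h (Phi *m t + colt (eps w)))%R])%E.
Arguments MSE {dp T R} P {n d} Phi eps h t.

Definition marginalized_MSE (dp : measure_display) (T : measurableType dp)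
    (R : realType) (P : probability T R) (n d : nat) (Phi : 'M[R]_(n, d))
    (eps : {RV P >-> n.-tuple R}) (theta : {RV P >-> d.-tuple R})
    (h : 'cV[R]_n -> 'cV[R]_d) : \bar R :=
  (\int[P]_w MSE P Phi eps h (colt (theta w)))%E.
Arguments marginalized_MSE {dp T R} P {n d} Phi eps theta h.

Definition linear_estimator (R : realType) (n d : nat) (K : 'M[R]_(d, n)) :
  'cV[R]_n -> 'cV[R]_d := fun y => K *m y.

(* Main.v *)
Require Import Defs.
From mathcomp Require Import all_boot all_order all_algebra.
From mathcomp Require Import all_classical all_reals all_analysis.
From mathcomp Require Import measurable_realfun ring lra.

Set Implicit Arguments.
Unset Strict Implicit.
Unset Printing Implicit Defensive.
Import Order.TTheory GRing.Theory Num.Theory.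
Import numFieldNormedType.Exports.

Local Open Scope classical_set_scope.
Local Open Scope ring_scope.

(** On the range of the covariance matrix of the data the weighted least squares
estimator is one explicit linear map K; the data almost surely lie in that
range; and K minimizes the risk among linear maps by completing the square.

Write S = Phi C Phi^T + V. If S v = 0 then the two nonnegative summands of
v^T S v vanish, hence so does C Phi^T v; therefore K = C Phi^T S^dagger
satisfies the normal equation K S = C Phi^T even when S is singular
(wls_gain_normal). On feasible points t = C u with y - Phi t = V v the
pseudoinverses cancel and the objective becomes u^T C u + v^T V v; for
y = S x, a feasible direction (p, q) satisfies Phi C p + V q = 0, hence is
orthogonal to (Phi^T x, x), and t = C Phi^T x is the unique minimizer; it is
K y by the normal equation (wls_argmin_gain).

A centred random vector almost surely lies in the range of its covariance
matrix V, because its projection 1 - V V^dagger has zero variance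
(centered_with_cov_range). So theta and eps almost surely lie in the ranges of
C and V, and then y lies in the range of S, where the weighted least squares
estimator is the linear map K. The estimator and K thus have the same
marginalized error (eq_marginalized_MSE).

The marginalized error of a linear estimator L is the trace of
(1 - L Phi) C0 (1 - L Phi)^T + L V0 L^T (marginalized_MSE_linear). Put
S0 = Phi C0 Phi^T + V0. The normal equation for (alpha C0, alpha V0) is alpha
times K S0 = C0 Phi^T, and with the latter the matrix above is a constant plus
(L - K) S0 (L - K)^T, which has nonnegative trace and vanishes at L = K
(bayes_risk_min). *)

(** * Positive semidefinite matrices *)

Lemma mxDE (V : nmodType) m n (A B : 'M[V]_(m, n)) i j :
  (A + B) i j = A i j + B i j.
Proof. by rewrite mxE. Qed.

Lemma mxNE (V : zmodType) m n (A : 'M[V]_(m, n)) i j : (- A) i j = - A i j.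
Proof. by rewrite mxE. Qed.

Lemma mxZE (K : pzRingType) m n (a : K) (A : 'M[K]_(m, n)) i j :
  (a *: A) i j = a * A i j.
Proof. by rewrite mxE. Qed.

Lemma mulmx_cV_eq0 (K : pzRingType) m n (A : 'M[K]_(m, n)) :
  (forall v : 'cV_n, A *m v = 0) -> A = 0.
Proof.
move=> A0; apply/matrixP => i j.
by have /colP/(_ i) := A0 (delta_mx j 0); rewrite -colE !mxE.
Qed.

Lemma sqnorm2_ge0 (R : realType) n (x : 'cV[R]_n) : 0 <= sqnorm2 x.
Proof. by apply: sumr_ge0 => i _; exact: sqr_ge0. Qed.

Lemma sqnorm20 (R : realType) n : sqnorm2 (0 : 'cV[R]_n) = 0.
Proof. by apply: big1 => i _; rewrite mxE expr0n. Qed.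

Lemma sqnorm2_eq0 (R : realType) n (x : 'cV[R]_n) : sqnorm2 x = 0 -> x = 0.
Proof.
move/eqP; rewrite psumr_eq0 => [/allP x0|i _]; last exact: sqr_ge0.
apply/colP => i; have := x0 i (mem_index_enum i).
by rewrite /= sqrf_eq0 => /eqP ->; rewrite mxE.
Qed.

Section Psd.
Variable R : realType.

Lemma psdD n (A B : 'M[R]_n) : psd A -> psd B -> psd (A + B).
Proof.
move=> [AT A0] [BT B0]; split=> [|x]; first by rewrite linearD /= AT BT.
by rewrite mulmxDr mulmxDl mxE addr_ge0.
Qed.

Lemma psdZ n (a : R) (A : 'M[R]_n) : 0 <= a -> psd A -> psd (a *: A).
Proof.
move=> a0 [AT A0]; split=> [|x]; first by rewrite linearZ /= AT.
by rewrite -scalemxAr -scalemxAl mxE mulr_ge0.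
Qed.

Lemma psd_congr m n (M : 'M[R]_(m, n)) (A : 'M[R]_n) :
  psd A -> psd (M *m A *m M^T).
Proof.
move=> [AT A0]; split=> [|x]; first by rewrite !trmx_mul trmxK AT mulmxA.
by have := A0 (M^T *m x); rewrite trmx_mul trmxK !mulmxA.
Qed.

Lemma mxtrace_psd_ge0 n (A : 'M[R]_n) : psd A -> 0 <= \tr A.
Proof.
move=> [_ A0]; apply: sumr_ge0 => i _.
by have := A0 (delta_mx i 0); rewrite trmx_delta -rowE -colE !mxE.
Qed.

Lemma quadD n (A : 'M[R]_n) (x y : 'cV[R]_n) : A^T = A ->
  ((x + y)^T *m A *m (x + y)) 0 0 =
  (x^T *m A *m x) 0 0 + (y^T *m A *m y) 0 0 + (y^T *m A *m x) 0 0 *+ 2.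
Proof.
move=> AT; have e : (x^T *m A *m y) 0 0 = (y^T *m A *m x) 0 0.
  have -> : x^T *m A *m y = (y^T *m A *m x)^T.
    by rewrite !trmx_mul trmxK AT mulmxA.
  by rewrite mxE.
have -> : (x + y)^T = x^T + y^T by rewrite linearD.
by rewrite !(mulmxDl, mulmxDr) !mxDE e; ring.
Qed.

(** With y = A x, b = |y|^2 and c = y^T A y, the form takes the value
- b^2 (c + 2) at (c + 1) x - b y; nonnegativity forces b = 0. *)
Lemma psd_quad_eq0 n (A : 'M[R]_n) (x : 'cV[R]_n) :
  psd A -> (x^T *m A *m x) 0 0 = 0 -> A *m x = 0.
Proof.
move=> [AT A0] qx0; set y := A *m x.
have xA : x^T *m A = y^T by rewrite /y trmx_mul AT.
pose b : R := (y^T *m y) 0 0; pose c : R := (y^T *m A *m y) 0 0.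
have c0 : 0 <= c by exact: A0.
have := A0 ((c + 1) *: x - b *: y).
have -> : ((c + 1) *: x - b *: y)^T = (c + 1) *: x^T - b *: y^T.
  by rewrite linearB /= !linearZ.
rewrite !(mulmxBl, mulmxBr) -!(scalemxAl, scalemxAr).
rewrite xA -(mulmxA _ A x) -/y.
have -> : y^T *m x = 0.
  apply/matrixP => i j; rewrite !ord1 [RHS]mxE -qx0.
  by rewrite -xA.
rewrite !scaler0 sub0r !(mxDE, mxNE, mxZE) -/b -/c => h.
have b0 : b = 0.
  apply: contrapT => /eqP bn0.
  have b2 : 0 < b ^+ 2 by rewrite exprn_even_gt0.
  by have := mulr_ge0 c0 (ltW b2); rewrite expr2 in b2 *; lra.
apply: sqnorm2_eq0; rewrite -b0 /b mxE.
by apply: eq_bigr => j _; rewrite [X in X * _]mxE expr2.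
Qed.

(** On the kernel of A + B the forms of A and B sum to zero, and both are
nonnegative. *)
Lemma psdD_ker n k (A B : 'M[R]_n) (M : 'M[R]_(n, k)) :
  psd A -> psd B -> (A + B) *m M = 0 -> A *m M = 0.
Proof.
move=> Ap Bp M0; apply: mulmx_cV_eq0 => v; rewrite -mulmxA.
apply: psd_quad_eq0 => //; set w := M *m v.
have : (w^T *m (A + B) *m w) 0 0 = 0.
  by rewrite -mulmxA /w (mulmxA (A + B)) M0 mul0mx mulmx0 mxE.
rewrite mulmxDr mulmxDl mxE => /eqP.
by rewrite paddr_eq0 ?(proj2 Ap) ?(proj2 Bp)// => /andP[/eqP].
Qed.

End Psd.

(** * The weighted least squares problem *)

Lemma mx_rangeZ (R : realType) m n (a : R) (A : 'M[R]_(m, n)) x : a != 0 ->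
  mx_range A x -> mx_range (a *: A) x.
Proof.
move=> a0 [z _ <-]; exists (a^-1 *: z) => //.
by rewrite -scalemxAl -scalemxAr scalerA divff// scale1r.
Qed.

Section WLS.
Variables (R : realType) (n d : nat) (Phi : 'M[R]_(n, d)).
Variables (C : 'M[R]_d) (V : 'M[R]_n).
Hypotheses (hC : psd C) (hV : psd V).

Let S := Phi *m C *m Phi^T + V.

Definition wls_gain := C *m Phi^T *m mp_pinv S.

Let hS : psd S.
Proof. by apply: psdD => //; exact: psd_congr. Qed.

(** For invertible S this is immediate; in general it says that the kernel of S
is contained in that of C Phi^T. *)
Lemma wls_gain_normal : wls_gain *m S = C *m Phi^T.
Proof.
have [SXS _ _ _] := mp_pinvP S.
apply/eqP; rewrite -subr_eq0 -opprB oppr_eq0 /wls_gain -[X in X - _]mulmx1.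
rewrite -!mulmxA -mulmxBr -mulmxBr; set N := 1%:M - _.
have SN : S *m N = 0 by rewrite /N mulmxBr mulmx1 mulmxA SXS subrr.
have PN : Phi *m C *m Phi^T *m N = 0.
  by apply: psdD_ker SN => //; exact: psd_congr.
apply/eqP/mulmx_cV_eq0 => v; rewrite -!mulmxA.
apply: psd_quad_eq0 => //.
have -> : (Phi^T *m (N *m v))^T *m C *m (Phi^T *m (N *m v)) =
    (N *m v)^T *m (Phi *m C *m Phi^T *m N *m v).
  by rewrite trmx_mul trmxK !mulmxA.
by rewrite PN mul0mx mulmx0 mxE.
Qed.

(** Transposing the normal equation puts the range of Phi C inside that of S;
the range of V is then inside as well, since V = S - Phi C Phi^T. *)
Lemma mx_range_model t e :
  mx_range C t -> mx_range V e -> mx_range S (Phi *m t + e).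
Proof.
move=> [a _ <-] [b _ <-].
have [ST _] := hS.
have [G e1] : exists G, Phi *m C = S *m G.
  exists ((mp_pinv S)^T *m (Phi *m C)).
  have := wls_gain_normal; rewrite /wls_gain -!mulmxA => /(congr1 trmx).
  by rewrite !trmx_mul !trmxK (proj1 hC) ST !mulmxA => ->.
have e2 : V = S *m (1%:M - G *m Phi^T).
  by rewrite mulmxBr mulmx1 (mulmxA S) -e1 /S addrC addKr.
exists (G *m a + (1%:M - G *m Phi^T) *m b) => //.
by rewrite mulmxDr !(mulmxA S) -e1 -e2 mulmxA.
Qed.

Lemma wnorm_range m (W : 'M[R]_m) (x : 'cV[R]_m) : psd W ->
  wnorm (mp_pinv W) (W *m x) ^+ 2 = (x^T *m W *m x) 0 0.
Proof.
move=> [WT W0]; have [WXW _ _ _] := mp_pinvP W.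
have e : (W *m x)^T *m mp_pinv W *m (W *m x) = x^T *m W *m x.
  by rewrite trmx_mul WT -!mulmxA (mulmxA W) (mulmxA (W *m _)) WXW.
by rewrite /wnorm e sqr_sqrtr.
Qed.

(** The feasible set is parametrized by t = C u and y - Phi t = V v; neither u
nor v is determined by t, but the objective depends only on C u and V v. *)
Lemma wls_argmin_gain z : mx_range S z ->
  wls_argmin Phi C V z = [set wls_gain *m z].
Proof.
move=> [x _ <-]; rewrite mulmxA wls_gain_normal.
have obj u v : S *m x - Phi *m (C *m u) = V *m v ->
  wls_objective Phi C V (S *m x) (C *m u) =
  (x^T *m S *m x) 0 0
  + ((u - Phi^T *m x)^T *m C *m (u - Phi^T *m x)) 0 0
  + ((v - x)^T *m V *m (v - x)) 0 0.
  move=> uv; rewrite /wls_objective uv !wnorm_range//.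
  (* (p, q) is a feasible direction; pq' says that it is orthogonal to
     (Phi^T x, x) for the form diag(C, V), so the cross terms cancel. *)
  set p := u - _; set q := v - x.
  have -> : u = p + Phi^T *m x by rewrite /p subrK.
  have -> : v = q + x by rewrite /q subrK.
  have pq : Phi *m (C *m p) + V *m q = 0.
    rewrite /p /q !mulmxBr -uv /S mulmxDl !mulmxA.
    by apply/colP => i; rewrite !mxE; ring.
  have := congr1 (fun M => (x^T *m M) 0 0) pq.
  rewrite mulmxDr mulmx0 !mulmxA mxDE [RHS]mxE => pq'.
  clearbody p q; rewrite !quadD ?(proj1 hC) ?(proj1 hV)// !trmx_mul !trmxK.
  by rewrite /S !(mulmxDl, mulmxDr) !mulmxA !mxDE; lra.
have quad0 m (A : 'M[R]_m) : ((0 : 'cV_m)^T *m A *m 0) 0 0 = 0.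
  by rewrite mulmx0 mxE.
have res : S *m x - Phi *m (C *m (Phi^T *m x)) = V *m x.
  by rewrite /S mulmxDl !mulmxA addrC addKr.
have obj0 : wls_objective Phi C V (S *m x) (C *m (Phi^T *m x)) =
    (x^T *m S *m x) 0 0.
  by rewrite (obj _ _ res) !subrr !quad0 !addr0.
have feas : wls_feasible Phi C V (S *m x) (C *m (Phi^T *m x)).
  by rewrite /wls_feasible /= res; split; [exists x | exists (Phi^T *m x)].
rewrite -mulmxA; apply/seteqP; split => [t [[[v _ vE] [u _ uE]]]|_ ->].
  subst t => /(_ _ feas); rewrite (obj u v)// obj0 => le.
  have := proj2 hC (u - Phi^T *m x); have := proj2 hV (v - x) => q0 p0.
  apply/eqP; rewrite -subr_eq0 -mulmxBr; apply/eqP/psd_quad_eq0 => //.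
  by apply/eqP; rewrite eq_le p0 andbT; lra.
split=> // t [[v _ vE] [u _ uE]]; subst t; rewrite (obj u v)// obj0.
by have := proj2 hC (u - Phi^T *m x); have := proj2 hV (v - x); lra.
Qed.

End WLS.

(** * The risk of a linear estimator *)

Section Risk.
Variables (R : realType) (n d : nat) (Phi : 'M[R]_(n, d)).
Variables (C : 'M[R]_d) (V : 'M[R]_n).
Hypotheses (hC : psd C) (hV : psd V).

Definition bayes_risk (K : 'M[R]_(d, n)) : R :=
  \tr ((1%:M - K *m Phi) *m C *m (1%:M - K *m Phi)^T) + \tr (K *m V *m K^T).

(** Completing the square around a solution of the normal equation. *)
Lemma bayes_risk_min K0 K :
  K0 *m (Phi *m C *m Phi^T + V) = C *m Phi^T -> bayes_risk K0 <= bayes_risk K.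
Proof.
set S := Phi *m C *m Phi^T + V => K0E.
have hS : psd S by apply: psdD => //; exact: psd_congr.
have K0ET : S *m K0^T = Phi *m C.
  have := congr1 trmx K0E; rewrite !trmx_mul trmxK.
  by rewrite (proj1 hC) (proj1 hS).
have riskE L : bayes_risk L =
    \tr (C - K0 *m S *m K0^T) + \tr ((L - K0) *m S *m (L - K0)^T).
  rewrite /bayes_risk -!mxtraceD; congr (\tr _).
  have -> : (1%:M - L *m Phi)^T = 1%:M - Phi^T *m L^T.
    by rewrite linearB /= trmx1 trmx_mul.
  have -> : (L - K0)^T = L^T - K0^T by rewrite linearB.
  rewrite !(mulmxBl, mulmxBr) K0E -(mulmxA L S K0^T) K0ET.
  rewrite /S mulmxDr mulmxDl !mul1mx !mulmx1 !mulmxA.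
  by apply/matrixP => i j; rewrite !(mxDE, mxNE); ring.
rewrite !riskE lerD2l subrr !mul0mx mxtrace0.
exact/mxtrace_psd_ge0/psd_congr.
Qed.

End Risk.

(** * Integrals of almost everywhere equal functions *)

Section AeIntegral.
Import HBNNSimple.
Local Open Scope ereal_scope.
Context d (T : measurableType d) (R : realType).
Variable mu : {measure set T -> \bar R}.

(** The integral of a nonnegative function is a supremum over the simple functions
below it, and restricting a simple function to the complement of a null set
keeps its integral; this applies to arbitrary nonnegative functions. It allows
changing an estimator on a null set of data when nothing is known about the
measurability of its error. *)
Lemma le_integral_ae_nonmeasurable (f g : T -> \bar R) :
  (forall x, 0 <= f x) -> (forall x, 0 <= g x) ->
  {ae mu, forall x, f x = g x} -> \int[mu]_x f x <= \int[mu]_x g x.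
Proof.
move=> f0 g0 [N [mN N0 fgN]].
rewrite [leLHS]ge0_integralTE// [leRHS]ge0_integralTE//.
apply: ge_ereal_sup => _ [h /= hf <-].
have mNC : measurable (~` N) by exact: measurableC.
have -> : sintegral mu h = sintegral mu (proj_nnsfun h mNC).
  rewrite -!integralT_nnsfun (ge0_negligible_integral mN)//=; last 2 first.
  - exact/measurable_EFinP.
  - by move=> x _; rewrite lee_fin.
  rewrite setTD integral_mkcond; apply: eq_integral => x _ /=.
  rewrite patchE /= mindicE /=.
  by case: ifPn => _; rewrite ?mulr1 ?mulr0.
apply: ereal_sup_ubound; exists (proj_nnsfun h mNC) => //= x.
rewrite mindicE /=; have [|xN] := boolP (x \in ~` N); last by rewrite mulr0.
rewrite inE /= mulr1 => xN; rewrite (le_trans (hf x))//.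
suff -> : f x = g x by [].
by apply: contrapT => fg; apply: xN; exact: fgN.
Qed.

Lemma eq_integral_ae_nonmeasurable (f g : T -> \bar R) :
  (forall x, 0 <= f x) -> (forall x, 0 <= g x) ->
  {ae mu, forall x, f x = g x} -> \int[mu]_x f x = \int[mu]_x g x.
Proof.
move=> f0 g0 fg; apply/eqP; rewrite eq_le.
rewrite !le_integral_ae_nonmeasurable//.
by apply: filterS fg => x ->.
Qed.

End AeIntegral.

(** * Second moments of centred random vectors *)

Section Moments.
Context (dp : measure_display) (T : measurableType dp) (R : realType).
Variable P : probability T R.

Lemma Lfun1_sum (I : finType) (F : I -> T -> R) :
  (forall i, F i \in Lfun P 1) -> (fun w => \sum_i F i w) \in Lfun P 1.
Proof.
move=> F1; have -> : (fun w => \sum_i F i w) = \sum_i F i.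
  by apply/funext => w; rewrite fct_sumE.
by rewrite rpred_sum.
Qed.

Lemma expectation_fin_sum (I : finType) (F : I -> T -> R) :
  (forall i, F i \in Lfun P 1) ->
  'E_P[(fun w => \sum_i F i w)%R]%E = (\sum_i 'E_P[F i])%E.
Proof.
move=> F1; have -> : (fun w => \sum_i F i w) = \sum_(f <- [seq F i | i : I]) f.
  by apply/funext => w; rewrite big_map fct_sumE big_enum.
rewrite expectation_sum ?big_map ?big_enum//.
by move=> _ /mapP[i _ ->].
Qed.

Variables (n : nat) (X : {RV P >-> n.-tuple R}) (V : 'M[R]_n).
Hypothesis hX : centered_with_cov P X V.

Let comp i : T -> R := fun w => tnth (X w) i.

Let comp1 i : comp i \in Lfun P 1.
Proof.
have [X2 _ _] := hX.
by apply: (Lfun_subset12 _ (X2 i)); exact: fin_num_measure.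
Qed.

Let comp11 i j : comp i \* comp j \in Lfun P 1.
Proof. by have [X2 _ _] := hX; exact: (Lfun2_mul_Lfun1 (X2 i) (X2 j)). Qed.

Let Ecomp11 i j : 'E_P[(comp i \* comp j)%R]%E = (V i j)%:E.
Proof.
have [_ X0 <-] := hX.
by rewrite (covarianceE (comp1 i) (comp1 j) (comp11 i j)) X0 mul0e sube0.
Qed.

Let coord m (M : 'M[R]_(m, n)) i : T -> R := fun w => \sum_j M i j * comp j w.

Let quad m (M : 'M[R]_(m, n)) i : T -> R := fun w =>
  \sum_j \sum_k ((M i j * M i k) \o* (comp j \* comp k)) w.

Let affine_sqr m (c : 'cV[R]_m) (M : 'M[R]_(m, n)) i :
  (fun w => (c i 0 + coord M i w) ^+ 2) =
  cst (c i 0 ^+ 2) \+ (((2 * c i 0) \o* coord M i) \+ quad M i).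
Proof.
apply/funext => w /=; rewrite sqrrD -addrA; congr (_ + (_ + _)).
  by rewrite -mulrnAl -mulr_natl mulrC.
rewrite expr2 mulr_suml; apply: eq_bigr => j _.
by rewrite mulr_sumr; apply: eq_bigr => k _ /=; ring.
Qed.

Let coord1 m (M : 'M[R]_(m, n)) i : coord M i \in Lfun P 1.
Proof.
apply: Lfun1_sum => j.
have -> : (fun w => M i j * comp j w) = M i j \o* comp j.
  by apply/funext => w /=; rewrite mulrC.
exact: Lfun_scale.
Qed.

Let Ecoord m (M : 'M[R]_(m, n)) i : 'E_P[coord M i]%E = 0%E.
Proof.
have [_ X0 _] := hX.
have e j : (fun w => M i j * comp j w) = M i j \o* comp j.
  by apply/funext => w /=; rewrite mulrC.
rewrite expectation_fin_sum => [|j]; last by rewrite e Lfun_scale.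
by rewrite big1// => j _; rewrite e expectationZl// X0 mule0.
Qed.

Let quad1 m (M : 'M[R]_(m, n)) i : quad M i \in Lfun P 1.
Proof.
by apply: Lfun1_sum => j; apply: Lfun1_sum => k; exact: Lfun_scale (comp11 j k).
Qed.

Let Equad m (M : 'M[R]_(m, n)) i :
  ('E_P[quad M i] = ((M *m V *m M^T) i i)%:E)%E.
Proof.
rewrite expectation_fin_sum => [|j]; last first.
  by apply: Lfun1_sum => k; exact: Lfun_scale (comp11 j k).
rewrite mxE -sumEFin; under [RHS]eq_bigr do rewrite mxE mulr_suml -sumEFin.
rewrite [RHS]exchange_big /=; apply: eq_bigr => j _.
rewrite expectation_fin_sum => [|k]; last exact: Lfun_scale (comp11 j k).
apply: eq_bigr => k _; rewrite (expectationZl _ (comp11 j k)) Ecomp11 -EFinM.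
by rewrite mxE; congr EFin; ring.
Qed.

Let affine1 m (c : 'cV[R]_m) (M : 'M[R]_(m, n)) i :
  ((2 * c i 0) \o* coord M i) \+ quad M i \in Lfun P 1.
Proof. by rewrite rpredD//=; exact: Lfun_scale. Qed.

Let affine_sqr1 m (c : 'cV[R]_m) (M : 'M[R]_(m, n)) i :
  (fun w => (c i 0 + coord M i w) ^+ 2) \in Lfun P 1.
Proof. by rewrite affine_sqr rpredD//=; exact: Lfun_cst. Qed.

Let sqnorm2E m (c : 'cV[R]_m) (M : 'M[R]_(m, n)) :
  (fun w => sqnorm2 (c + M *m colt (X w))) =
  (fun w => \sum_i (c i 0 + coord M i w) ^+ 2).
Proof.
apply/funext => w; apply: eq_bigr => i _; rewrite !mxE.
by congr ((_ + _) ^+ 2); apply: eq_bigr => j _; rewrite mxE.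
Qed.

Lemma Lfun1_sqnorm2_affine m (c : 'cV[R]_m) (M : 'M[R]_(m, n)) :
  (fun w => sqnorm2 (c + M *m colt (X w))) \in Lfun P 1.
Proof. by rewrite sqnorm2E; exact: Lfun1_sum. Qed.

(** Bias-variance decomposition: the cross term vanishes as X is centred. *)
Lemma expectation_sqnorm2_affine m (c : 'cV[R]_m) (M : 'M[R]_(m, n)) :
  'E_P[(fun w => sqnorm2 (c + M *m colt (X w)))%R]%E =
  (sqnorm2 c + \tr (M *m V *m M^T))%:E.
Proof.
rewrite sqnorm2E expectation_fin_sum// /sqnorm2 /mxtrace -big_split/= -sumEFin.
apply: eq_bigr => i _; rewrite affine_sqr.
rewrite (expectationD (Lfun_cst _ _ _) (affine1 c M i)).
rewrite (expectationD (Lfun_scale _ _ (coord1 M i)) (quad1 M i))//.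
rewrite expectation_cst (expectationZl _ (coord1 M i)) Ecoord mule0 add0e.
by rewrite Equad.
Qed.

(** The projection N = 1 - V V^dagger off the range of V satisfies
E |N X|^2 = tr (N V N^T) = 0. *)
Lemma centered_with_cov_range : {ae P, forall w, mx_range V (colt (X w))}.
Proof.
have [VXV _ _ _] := mp_pinvP V.
pose N := 1%:M - V *m mp_pinv V.
have NV : N *m V = 0 by rewrite mulmxBl mul1mx VXV subrr.
have := expectation_sqnorm2_affine 0 N.
rewrite NV mul0mx mxtrace0 addr0 sqnorm20.
have := Lfun1_sqnorm2_affine 0 N; set f := (fun w => _) => f1.
have f0 w : 0 <= f w by exact: sqnorm2_ge0.
rewrite unlock => If.
have mf : measurable_fun setT (EFin \o f).
  by have /Lfun1_integrable/measurable_int := f1.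
have : ae_eq P setT (EFin \o f) (cst 0%E).
  apply/ae_eq_integral_abs => //; rewrite -[RHS]If.
  by apply: eq_integral => w _ /=; rewrite ger0_norm.
apply: filterS => w /(_ I) [] /sqnorm2_eq0; rewrite add0r => Nw.
exists (mp_pinv V *m colt (X w)) => //.
by apply/esym/eqP; rewrite mulmxA -subr_eq0 -[X in X - _]mul1mx -mulmxBl Nw.
Qed.

End Moments.

(** * Marginalized mean-squared errors *)

Section MarginalizedMSE.
Context (dp : measure_display) (T : measurableType dp) (R : realType).
Variables (P : probability T R) (n d : nat) (Phi : 'M[R]_(n, d)).
Variables (theta : {RV P >-> d.-tuple R}) (eps : {RV P >-> n.-tuple R}).
Variables (C : 'M[R]_d) (V : 'M[R]_n).
Hypotheses (htheta : centered_with_cov P theta C).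
Hypotheses (heps : centered_with_cov P eps V).

Lemma marginalized_MSE_linear K :
  marginalized_MSE P Phi eps theta (linear_estimator K) =
  (bayes_risk Phi C V K)%:E.
Proof.
pose A := 1%:M - K *m Phi.
have E t : MSE P Phi eps (linear_estimator K) t =
    (sqnorm2 (A *m t) + \tr (K *m V *m K^T))%:E.
  (* The error is A t - K eps: an affine image of the noise with matrix - K. *)
  have -> : \tr (K *m V *m K^T) = \tr ((- K) *m V *m (- K)^T).
    by congr (\tr _); rewrite linearN /= mulmxN !mulNmx opprK.
  rewrite -(expectation_sqnorm2_affine heps) /MSE; congr expectation.
  apply/funext => w; congr sqnorm2.
  rewrite /linear_estimator /A mulmxDr mulmxBl mul1mx mulNmx mulmxA.
  by rewrite opprD addrA.
rewrite /marginalized_MSE; under eq_integral do rewrite E.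
have f1 : (fun w => sqnorm2 (A *m colt (theta w))) \in Lfun P 1.
  have := Lfun1_sqnorm2_affine htheta 0 A.
  by under eq_fun do rewrite add0r.
have := expectation_sqnorm2_affine htheta 0 A.
under eq_fun do rewrite add0r.
rewrite sqnorm20 add0r => EA.
have := expectationD f1 (Lfun_cst P (\tr (K *m V *m K^T)) 1).
by rewrite EA expectation_cst unlock -EFinD.
Qed.

(** Almost surely theta lies in the range of C and eps in that of V, so the
error only sees an estimator at data built from such vectors. *)
Lemma eq_marginalized_MSE h1 h2 :
  (forall t e, mx_range C t -> mx_range V e ->
     h1 (Phi *m t + e) = h2 (Phi *m t + e)) ->
  marginalized_MSE P Phi eps theta h1 = marginalized_MSE P Phi eps theta h2.
Proof.
move=> h12.
have mse0 h t : (0 <= MSE P Phi eps h t)%E.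
  by apply: expectation_ge0 => w; exact: sqnorm2_ge0.
apply: eq_integral_ae_nonmeasurable => //.
apply: filterS (centered_with_cov_range htheta) => w tw.
rewrite /MSE unlock; apply: eq_integral_ae_nonmeasurable.
- by move=> v; rewrite lee_fin sqnorm2_ge0.
- by move=> v; rewrite lee_fin sqnorm2_ge0.
apply: filterS (centered_with_cov_range heps) => v ev.
by rewrite h12.
Qed.

End MarginalizedMSE.

Theorem theorem4 (R : realType) (dp : measure_display) (T : measurableType dp)
  (P : probability T R) (n d : nat) (Phi : 'M[R]_(n, d))
  (C0 : 'M[R]_d) (V0 : 'M[R]_n)
  (theta : {RV P >-> d.-tuple R}) (eps : {RV P >-> n.-tuple R})
  (y : T -> 'cV[R]_n) (alpha : R)
  (hC0 : psd C0) (hV0 : psd V0)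
  (htheta : centered_with_cov P theta C0)
  (heps : centered_with_cov P eps V0)
  (hind : independent_RV P theta eps)
  (hy : forall w, y w = Phi *m colt (theta w) + colt (eps w))
  (halpha : 0 < alpha) :
  let C := alpha *: C0 in
  let V := alpha *: V0 in
  let theta_hat := wls_estimator Phi C V in
  [/\ {ae P, forall w, wls_argmin Phi C V (y w) = [set theta_hat (y w)]},
      exists2 K : 'M[R]_(d, n),
        forall z, mx_range (Phi *m C *m Phi^T + V) z ->
          theta_hat z = linear_estimator K z &
        marginalized_MSE P Phi eps theta theta_hat =
          marginalized_MSE P Phi eps theta (linear_estimator K) &
      forall K : 'M[R]_(d, n),
        (marginalized_MSE P Phi eps theta theta_hat <=
         marginalized_MSE P Phi eps theta (linear_estimator K))%E].
Proof.
move=> C V theta_hat.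
have a0 : alpha != 0 by rewrite gt_eqF.
have hC : psd C by apply: psdZ => //; exact: ltW.
have hV : psd V by apply: psdZ => //; exact: ltW.
have hatE z : mx_range (Phi *m C *m Phi^T + V) z ->
    theta_hat z = wls_gain Phi C V *m z.
  move=> /(wls_argmin_gain hC hV) argE; rewrite /theta_hat /wls_estimator argE.
  set Kz := wls_gain Phi C V *m z.
  by apply: (xgetPex 0 (P := [set Kz])); exists Kz.
(* The ranges of alpha C0 and alpha V0 are those of C0 and V0. *)
have data t e : mx_range C0 t -> mx_range V0 e ->
    mx_range (Phi *m C *m Phi^T + V) (Phi *m t + e).
  by move=> tC eV; apply: mx_range_model => //; exact: mx_rangeZ.
have mseE : marginalized_MSE P Phi eps theta theta_hat =
    marginalized_MSE P Phi eps theta (linear_estimator (wls_gain Phi C V)).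
  apply: (eq_marginalized_MSE htheta heps) => t e tC eV.
  by rewrite hatE//; exact: data.
split.
- apply: filterS2 (centered_with_cov_range htheta)
    (centered_with_cov_range heps) => w tw ew.
  by rewrite hy hatE ?wls_argmin_gain//; exact: data.
- by exists (wls_gain Phi C V).
- move=> K; rewrite mseE !(marginalized_MSE_linear _ htheta heps) lee_fin.
  apply: bayes_risk_min => //; apply: (scalerI a0).
  have := wls_gain_normal Phi hC hV.
  by rewrite /C /V -!scalemxAr -!scalemxAl -scalerDr -scalemxAr.
Qed.
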